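(* Let $d$ be any non-negative integer constant and let $\Delta = 2d+2$. Then there is no deterministic distributed algorithm in the LOCAL model that runs in $o(\log^* n)$ rounds, where $n$ is the number of nodes of the input graph, and that finds a maximal fractional matching in every graph of maximum degree at most $\Delta$ using only edge values of the form $a/b$ with $a \in \{0,1,\dotsc,2^d\}$ and $b\in\{1,2,\dotsc,2^d\}$. (Here $d$ is fixed, and the constants hidden in the $o$-notation may depend on $d$.)
   Context: Fractional matching: for a finite simple graph $G=(V,E)$ and $x\colon E\to[0,1]$, write $x[v]=\sum_{e\in E: v\in e} x(e)$ for $v \in V$. The function $x$ is a fractional matching if $x[v]\le 1$ for all $v\in V$; it is a maximal fractional matching if in addition for every edge $\{u,v\}\in E$ at least one endpoint is saturated, i.e. $x[u]=1$ or $x[v]=1$. PN (port-numbering) model: each node of the input graph $G$ is a computer and each edge is a communication link. An adversary chooses a port numbering: each node $v$ of degree $\deg(v)$ refers to its incident edges by the numbers $1,\dotsc,\deg(v)$. Initially each node knows only its degree (and the global constant $\Delta$), and nodes of the same degree start in the same state. Computation is deterministic and proceeds in synchronous rounds; in each round each node sends a message (of arbitrary size) through each port, receives a message from each port, and updates its state by arbitrary local computation as a function of its current state and the received messages. A node may stop after any number of rounds and announce its local output, here the value $x(e)$ of each incident edge $e$ (the two endpoints of an edge must announce the same value). The running time is the number of rounds until all nodes have stopped; as a function of $n$ it is the worst case over all inputs with $n$ nodes. An algorithm must be correct for every input graph in the family and every port numbering. LOCAL model: the same as the PN model, except that each node is additionally given as input a unique identifier, chosen by an adversary from a set of size polynomial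 in $n=|V|$, e.g. $\{1,\dotsc,n^c\}$ for a fixed constant $c \ge 1$. An algorithm must be correct for every choice of unique identifiers. $\log^* n$ denotes the iterated logarithm. *)

(* Defs.v *)
From HB Require Import structures.
From mathcomp Require Import all_boot all_order all_algebra.

Set Implicit Arguments.
Unset Strict Implicit.
Unset Printing Implicit Defensive.

Import Order.TTheory GRing.Theory Num.Theory.

Record graph := Graph {
  vertex :> finType;
  adj : rel vertex;
  adj_sym : symmetric adj;
  adj_irrefl : irreflexive adj
}.

Definition edges (G : graph) : {set {set G}} :=
  [set e : {set G} | [exists u, exists v, adj u v && (e == [set u; v])]].

Definition deg (G : graph) (v : G) : nat := #|[pred u | adj v u]|.

Definition max_degree (G : graph) : nat := \max_(v : G) deg v.

Section FractionalMatching.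
Local Open Scope ring_scope.

Definition load (G : graph) (x : {set G} -> rat) (v : G) : rat :=
  \sum_(e in edges G | v \in e) x e.

Definition fractional_matching (G : graph) (x : {set G} -> rat) : Prop :=
  (forall e, e \in edges G -> 0 <= x e <= 1) /\ (forall v, load x v <= 1).

Definition maximal_fractional_matching (G : graph) (x : {set G} -> rat) : Prop :=
  fractional_matching x /\
  forall u v : G, adj u v -> load x u = 1 \/ load x v = 1.

Definition allowed_value (d : nat) (q : rat) : Prop :=
  exists a b : nat,
    [/\ (a <= 2 ^ d)%N, (1 <= b <= 2 ^ d)%N & q = a%:R / b%:R].

End FractionalMatching.

(* In a simple graph, numbering the edges incident to v amounts to listing the
   neighbours of v in some order; the port of v leading to its neighbour u is
   then [index u (p v)], so ports are counted from 0. *)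
Definition port_numbering (G : graph) (p : G -> seq G) : Prop :=
  forall v, uniq (p v) /\ forall u, (u \in p v) = adj v u.

Definition identifiers (c : nat) (G : graph) (id : G -> nat) : Prop :=
  injective id /\ forall v, 1 <= id v <= #|G| ^ c.

(* [init k i] is the initial state of a node of degree k with identifier i;
   [recv s m] is the new state of a node in state s that received the messages
   m, listed by port. A state s with [output s = Some o] is a stopping state, in
   which the node announces the value [o j] for the edge at port j. *)
Record local_algorithm := LocalAlgorithm {
  state : Type;
  message : Type;
  init : nat -> nat -> state;
  send : state -> nat -> message;
  recv : state -> seq message -> state;
  output : state -> option (nat -> rat)
}.

(* A stopped node never changes its state again, but its neighbours still
   receive the messages determined by its stopping state. *)
Fixpoint run (A : local_algorithm) (G : graph) (p : G -> seq G) (id : G -> nat)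
    (t : nat) : G -> state A :=
  if t is t'.+1 then
    let s := run A p id t' in
    fun v =>
      if output (s v) is Some _ then s v
      else recv (s v) [seq send (s u) (index v (p u)) | u <- p v]
  else fun v => init A (deg v) (id v).

Definition computes_within (A : local_algorithm) (G : graph) (p : G -> seq G)
    (id : G -> nat) (t : nat) (x : {set G} -> rat) : Prop :=
  forall v, exists2 o, output (run A p id t v) = Some o &
    forall u, adj v u -> o (index u (p v)) = x [set v; u].

Lemma up_log2_lt n : 1 < n -> up_log 2 n < n.
Proof.
case: n => [|[|n]] // _.
have h : n.+2 <= 2 ^ n.+1 by apply: ltn_expl.
by rewrite ltnS; apply: up_log_min.
Qed.

Lemma iter_up_log2_le1 n : exists k, iter k (up_log 2) n <= 1.
Proof.
elim/ltn_ind: n => n IHn; case: (leqP n 1) => [|n_gt1]; first by exists 0.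
by have [k hk] := IHn _ (up_log2_lt n_gt1); exists k.+1; rewrite iterSr.
Qed.

(* [up_log 2] is the binary logarithm rounded up. Rounding up does not change the
   number of iterations needed to reach a value at most 1, because
   log2 x <= m if and only if x <= 2 ^ m, and 2 ^ m is an integer. *)
Definition log_star (n : nat) : nat := ex_minn (iter_up_log2_le1 n).

Definition little_o (f g : nat -> nat) : Prop :=
  forall eps : rat, (0 < eps)%R ->
    exists N, forall n, N <= n -> ((f n)%:R <= eps * (g n)%:R)%R.

(* Main.v *)
Require Import Defs.
From mathcomp Require Import all_boot all_order all_algebra.
From mathcomp Require Import zify ring.
Set Implicit Arguments.
Unset Strict Implicit.
Unset Printing Implicit Defensive.
Import Order.TTheory GRing.Theory Num.Theory.

(** Let D = d + 1 and let the input be a D-dimensional grid, with one end of each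
direction at coordinate 0. The identifier of a node is a word of D letters, the
i-th letter depending only on the i-th coordinate, so a node that runs t rounds
sees only O(t) letters in each direction. The shift-graph argument (a colouring
of increasing tuples gives some tuple and its shift the same colour unless the
alphabet is at most a tower of height linear in the length) therefore yields
letters for which, at every node k with 0 <= k_i <= f and k_b = f, the values
announced around k and around k + e_b agree, as soon as log* n exceeds a
constant times t. Hence such a k is saturated, as k and k + e_b have equal loads,
and its two edges in direction b have equal values.

Take f odd. For a set A of directions let P(A, b) be the sum, over the nodes k
with k_i = f for i outside A, of (-1)^(sum of k_i over A) x_b(k), where x_b(k) is
the value of the edge from k to k + e_b. Summing the saturation equations of
these nodes with the same signs, the edges in the directions of A telescope:
2 sum_(b notin A) P(A, b) - sum_(a in A) P(A \ a, a) = [A = 0] whenever A misses a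
direction. Adding these identities with weights 2^|A| leaves
2^D sum_b P(~b, b) = 1, so that some value has 2-adic valuation at most -(d + 1),
which no a / b with b <= 2^d has. *)

(** * Shifted tuples of the same colour *)

(* The set of colours of the one-point extensions of a tuple is a colouring of
   shorter tuples with 2 ^ q colours; r such reductions leave the pigeonhole
   principle. *)
Lemma shift_lemma r (C : finType) (c : seq nat -> C) N :
  iter r (expn 2) #|C| < N ->
  exists x s, [/\ size s = r.+1, path ltn x s, all (gtn N) (x :: s)
                & c (belast x s) = c s].
Proof.
elim: r C c => [|r IHr] C c /= ltN.
  have /injectivePn[i [j neq_ij eq_c]] : ~~ injectiveb (fun i : 'I_N => c [:: val i]).
    by apply: contraL ltN => /injectiveP/leq_card; rewrite card_ord -leqNgt.
  have [lt_ij | lt_ji | /val_inj/eqP] := ltngtP i j; last by rewrite (negPf neq_ij).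
    by exists (val i), [:: val j]; rewrite /= lt_ij !ltn_ord.
  by exists (val j), [:: val i]; rewrite /= lt_ji !ltn_ord.
pose c' w := [set c (rcons w (val b)) | b : 'I_N & last 0 w < b].
have [|x [s [sz_s path_s lt_s eq_c']]] := IHr {set C} c'.
  by rewrite -cardsT -powersetT card_powerset cardsT -iterSr.
have s_neq0 : s != [::] by rewrite -size_eq0 sz_s.
have lastE y : last y s = last x s by case: (s) s_neq0.
have lt_last : last x s < N.
  by move/allP: lt_s; apply; apply: mem_last.
(* [x :: s] extends [belast x s], so its colour lies in [c' (belast x s)], which is [c' s]: some
   extension of [s] has that colour too. *)
have : c (x :: s) \in c' s.
  rewrite -eq_c' lastI; apply/imsetP; exists (Ordinal lt_last) => //=.
  rewrite inE /=.
  case/lastP: (s) sz_s path_s => [//|t y] _; rewrite rcons_path => /andP[_ lt_y].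
  rewrite belast_rcons last_rcons /=; exact: lt_y.
case/imsetP => b; rewrite inE lastE => lt_b eq_c.
exists x, (rcons s b); split.
- by rewrite size_rcons sz_s.
- by rewrite rcons_path path_s.
- by rewrite /= all_rcons /= ltn_ord /=.
- by rewrite belast_rcons.
Qed.

Fixpoint seqs_over (T : Type) (l : seq T) n : seq (seq T) :=
  if n is n'.+1 then [seq x :: s | x <- l, s <- seqs_over l n'] else [:: [::]].

Lemma size_seqs_over (T : Type) (l : seq T) n : size (seqs_over l n) = size l ^ n.
Proof. by elim: n => //= n IHn; rewrite size_allpairs IHn expnS. Qed.

Lemma mem_seqs_over (T : eqType) (l s : seq T) :
  all (mem l) s -> s \in seqs_over l (size s).
Proof.
elim: s => //= x s IHs /andP[l_x /IHs l_s].
by apply/allpairsP; exists (x, s).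
Qed.

Fixpoint box_bound r q D : nat :=
  if D is D'.+1 then
    box_bound r q D' + (iter r (expn 2) (q ^ (box_bound r q D' ^ r.+1) ^ D')).+1
  else 0.

Definition increasing_below N n (s : seq nat) :=
  [&& sorted ltn s, size s == n & all (gtn N) s].

(* The first direction is treated as a colouring by the tables of all the colours
   obtained from the windows of the remaining directions, hence the nested
   recursion of [box_bound]. *)
Lemma shift_box r D (C : finType) (c : seq (seq nat) -> C) :
  exists S : seq (seq nat),
    [/\ size S = D, all (increasing_below (box_bound r #|C| D) r.+2) S
      & forall b, b < D ->
          c [seq take r.+1 s | s <- S] =
          c (set_nth [::] [seq take r.+1 s | s <- S] b (behead (nth [::] S b)))].
Proof.
elim: D c => [|D IHD] c; first by exists [::].
set N := box_bound r #|C| D in IHD.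
pose W := seqs_over (seqs_over (iota 0 N) r.+1) D.
pose c1 s := map_tuple (fun w => c (s :: w)) (in_tuple W).
have [|x [s [sz_s path_s lt_s eq_c1]]] := @shift_lemma r _ c1
    (iter r (expn 2) (#|C| ^ (N ^ r.+1) ^ D)).+1.
  by rewrite card_tuple /W !size_seqs_over size_iota.
have [S [sz_S inc_S eq_S]] := IHD (fun w => c (belast x s :: w)).
have take_s : take r.+1 (x :: s) = belast x s.
  by rewrite lastI -cats1 take_size_cat ?size_belast.
exists ((x :: s) :: S); split => [||b lt_b] /=.
- by rewrite sz_S.
- apply/andP; split.
    rewrite /increasing_below /= path_s sz_s eqxx /= -/N.
    by apply: sub_all lt_s => y /= /leq_trans->//; lia.
  apply: sub_all inc_S => t /and3P[? ? /allP lt_t]; apply/and3P; split => //.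
  apply/allP => y /lt_t /= /leq_trans-> //; rewrite -/N; lia.
- have -> : x :: take r s = belast x s by rewrite -take_s.
  case: b lt_b => [|b] lt_b /=; last exact: eq_S.
  set w := map _ S.
  have Ww : w \in W.
    have sz_w : size w = D by rewrite size_map.
    rewrite /W -[X in seqs_over _ X]sz_w.
    apply: mem_seqs_over; apply/allP => _ /mapP[t /(allP inc_S) /and3P[_ /eqP sz_t lt_t] ->].
    have {1}-> : r.+1 = size (take r.+1 t) by rewrite size_take sz_t ltnS leqnn.
    rewrite inE; apply: mem_seqs_over; apply/allP => y /mem_take /(allP lt_t) /=.
    by rewrite mem_iota.
  have /(congr1 (fun t => nth (c [::]) t (index w W))) /= := congr1 val eq_c1.
  by rewrite !(nth_map [::]) ?index_mem // !nth_index.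
Qed.

(** * Towers of exponentials and the iterated logarithm *)

Lemma tower_ge k n : n <= iter k (expn 2) n.
Proof. by elim: k => //= k IHk; apply: leq_trans IHk (ltnW (ltn_expl _ _)). Qed.

Lemma tower_mono k : {homo iter k (expn 2) : m n / m <= n}.
Proof. by move=> m n le_mn; elim: k => //= k; apply: leq_pexp2l. Qed.

Lemma tower_index_mono n k k' :
  k <= k' -> iter k (expn 2) n <= iter k' (expn 2) n.
Proof. by move=> /subnK <-; rewrite iterD tower_ge. Qed.

Lemma leq_tower1 k : k <= iter k (expn 2) 1.
Proof. by elim: k => //= k IHk; apply: leq_ltn_trans IHk (ltn_expl _ _). Qed.

Lemma leq_expn2l m n e : m <= n -> m ^ e <= n ^ e.
Proof. by move=> le_mn; case: e => // e; rewrite leq_exp2r. Qed.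

Lemma sqr_le_tower n : n * n <= iter 2 (expn 2) n.
Proof.
apply: leq_trans (_ : n ^ 2 <= _); first by rewrite -mulnn.
apply: leq_trans (leq_expn2l 2 (ltnW (ltn_expl n (isT : 1 < 2)))) _.
rewrite -expnM /= leq_exp2l //.
by case: n => // n; rewrite mulnC expnS leq_mul2l /= ltn_expl.
Qed.

Lemma exp_self_le_tower n : n ^ n <= iter 3 (expn 2) n.
Proof.
apply: leq_trans (leq_expn2l n (ltnW (ltn_expl n (isT : 1 < 2)))) _.
by rewrite -expnM iterS leq_exp2l // sqr_le_tower.
Qed.

(** Each direction adds at most [r + 7] exponentials: six bound the number of tables in terms of the
    bound [y] for the previous directions, [r] come from the shift lemma, and one absorbs the
    sum. *)
Lemma box_bound_le r q D Z :
  0 < q -> q <= Z -> r.+1 * D <= Z ->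
  box_bound r q D <= iter (D * (r + 7)) (expn 2) Z.
Proof.
move=> q_gt0 le_qZ; elim: D => //= D IHD le_rD.
set B := box_bound r q D in IHD *; set y := iter (D * (r + 7)) (expn 2) Z in IHD.
have le_Zy : Z <= y by apply: tower_ge.
have {}IHD : B <= y by apply: IHD; apply: leq_trans le_rD; rewrite leq_mul2l leqnSn orbT.
have y_gt0 : 0 < y by apply: leq_trans q_gt0 (leq_trans le_qZ le_Zy).
have le_exp : q ^ (B ^ r.+1) ^ D <= iter 6 (expn 2) y.
  have h1 : (B ^ r.+1) ^ D <= y ^ y.
    rewrite -expnM; apply: leq_trans (_ : y ^ (r.+1 * D) <= _).
      exact: leq_expn2l.
    apply: leq_pexp2l => //; apply: leq_trans le_Zy; apply: leq_trans le_rD.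
    by rewrite leq_mul2l leqnSn orbT.
  have h2 : q <= y ^ y.
    apply: leq_trans (leq_trans le_qZ le_Zy) _.
    by case: (y) y_gt0 => // n _; rewrite expnS leq_pmulr // expn_gt0.
  have yy0 : 0 < y ^ y by rewrite expn_gt0 y_gt0.
  apply: leq_trans (_ : (y ^ y) ^ (y ^ y) <= _).
    apply: leq_trans (leq_pexp2l q_gt0 h1) _.
    by rewrite leq_exp2r.
  apply: leq_trans (exp_self_le_tower _) _.
  rewrite (iterD 3 3); apply: tower_mono; exact: exp_self_le_tower.
have -> : D.+1 * (r + 7) = (r + 7) + D * (r + 7) by lia.
rewrite iterD -/y addnS.
have -> : r + 7 = (r + 6).+1 by lia.
rewrite iterS iterD.
set w := iter r _ (iter 6 _ y).
have le_yw : y <= w by apply: leq_trans (tower_ge 6 y) (tower_ge r _).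
apply: leq_ltn_trans (leq_add IHD (tower_mono r le_exp)) _.
rewrite -/w; apply: leq_ltn_trans (leq_add le_yw (leqnn w)) _.
have : 3 <= w.
  apply: leq_trans (tower_ge r _); apply: leq_trans (tower_mono 6 y_gt0).
  by apply: leq_trans (tower_index_mono 1 (isT : 2 <= 6)).
by elim: (w) => // -[|[|[|m]]] // IH _; rewrite expnS; move: (IH isT); lia.
Qed.

Lemma log_star_le n k : n <= iter k (expn 2) 1 -> log_star n <= k.
Proof.
move=> le_n; rewrite /log_star; case: ex_minnP => m _; apply; move: le_n.
elim: k n => //= k IHk n le_n; rewrite -/(iter k.+1 (up_log 2) n) iterSr.
by apply/IHk/up_log_min.
Qed.

Lemma log_star_box_bound D Q f :
  0 < Q -> Q * D * 2 < f ->
  log_star ((box_bound f.*2 (Q ^ (f.+1 ^ D * D * 2)) D).+1 ^ D) <= (9 * D + 15) * f.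
Proof.
move=> Q_gt0 lt_f.
set q := Q ^ _; set m := f.+1; pose Z := q + f.*2.+1 * D.
have le_Dm : D <= m by rewrite /m; nia.
have m_gt0 : 0 < m by [].
have mm_gt0 : 0 < m ^ m by rewrite expn_gt0.
have le_m_mm : m <= m ^ m by rewrite {2}/m expnS leq_pmulr // expn_gt0.
have le_q : q <= iter 6 (expn 2) m.
  apply: leq_trans (leq_expn2l _ (ltnW (ltn_expl Q (isT : 1 < 2)))) _.
  rewrite -expnM iterS leq_exp2l //.
  have -> : Q * (m ^ D * D * 2) = Q * D * 2 * m ^ D by lia.
  apply: leq_trans (_ : m ^ m * m ^ m <= _).
    by apply: leq_mul; [apply: leq_trans le_m_mm; rewrite /m; lia | apply: leq_pexp2l].
  apply: leq_trans (sqr_le_tower _) _.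
  rewrite (iterD 2 3); apply: tower_mono; exact: exp_self_le_tower.
have le_Z : Z <= iter 9 (expn 2) m.
  have h : f.*2.+1 * D <= iter 6 (expn 2) m.
    apply: leq_trans (_ : iter 2 (expn 2) m * iter 2 (expn 2) m <= _).
      apply: leq_mul; last by apply: leq_trans le_Dm _; apply: (tower_ge 2).
      apply: leq_trans (sqr_le_tower m); rewrite /m; lia.
    by apply: leq_trans (sqr_le_tower _) _; apply: (tower_index_mono m (isT : 4 <= 6)).
  apply: leq_trans (leq_add le_q h) _; rewrite (iterD 3 6); set y := iter 6 _ m.
  have : 0 < y by apply: leq_trans (tower_ge 6 m).
  rewrite !iterS; case: y => // y _; have := ltn_expl y.+1 (isT : 1 < 2).
  rewrite addnn -mul2n => lt_y.
  apply: leq_trans (_ : 2 ^ y.+1.+1 <= _); first by rewrite expnS leq_mul2l ltnW.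
  rewrite leq_exp2l //; apply: leq_trans lt_y _; apply: (tower_ge 1).
have q_gt0 : 0 < q by rewrite expn_gt0 Q_gt0.
have := @box_bound_le f.*2 q D Z q_gt0 (leq_addr _ _) (leq_addl _ _).
set N := box_bound _ _ _ => le_N.
set k := D * (f.*2 + 7) in le_N.
have le_N1 : N.+1 <= iter k.+1 (expn 2) Z.
  by rewrite iterS; apply: leq_ltn_trans le_N (ltn_expl _ _).
(* Tower heights: [m] to reach [m] from 1, 9 for [Z], [k.+1] for [N.+1], and 3 for the power [D]. *)
apply: (@leq_trans (3 + k.+1 + 9 + m)); last by rewrite /k /m; nia.
apply: log_star_le; rewrite 3!iterD.
apply: leq_trans (tower_mono 3 (tower_mono k.+1 (leq_trans le_Z (tower_mono 9 (leq_tower1 m))))).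
move: le_N1; set y := iter k.+1 _ Z => le_N1.
have le_Dy : D <= y.
  apply: leq_trans (tower_ge _ _); rewrite /Z; nia.
apply: leq_trans (exp_self_le_tower y).
apply: leq_trans (leq_expn2l _ le_N1) _.
by apply: leq_pexp2l => //; apply: leq_ltn_trans le_N1.
Qed.

(** * A conservation law for boxes with an even number of layers *)

Section GridIdentity.
Local Open Scope ring_scope.

Variables D f : nat.
Local Notation box := {ffun 'I_D -> 'I_f.+1}.
(** [X i k] and [Y i k] stand for the values of the edges leaving the node [k] forward and backward
    in direction [i]. *)
Variables X Y : 'I_D -> box -> rat.

Definition upd (k : box) (a : 'I_D) (x : 'I_f.+1) :=
  [ffun i => if i == a then x else k i].

Definition in_face (A : {set 'I_D}) (k : box) :=
  [forall i, (i \notin A) ==> (k i == ord_max)].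

Definition face_sign (A : {set 'I_D}) (k : box) : rat :=
  \prod_(i in A) (-1) ^+ k i.

(** This is P(A, b) of the overview. *)
Definition face_sum A b := \sum_(k | in_face A k) face_sign A k * X b k.

Hypothesis odd_f : odd f.
Hypothesis Y0 : forall i (k : box), k i = ord0 -> Y i k = 0.
Hypothesis YS : forall i (k : box), (k i < f)%N -> Y i (upd k i (inord (k i).+1)) = X i k.
Hypothesis Y_max : forall i (k : box), k i = ord_max -> Y i k = X i k.
Hypothesis saturated :
  forall (k : box) i, k i = ord_max -> \sum_i (X i k + Y i k) = 1.

Lemma upd_id (k : box) a x : k a = x -> upd k a x = k.
Proof. by move=> <-; apply/ffunP => i; rewrite ffunE; case: eqP => // ->. Qed.

Lemma upd_upd (k : box) a x y : upd (upd k a x) a y = upd k a y.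
Proof. by apply/ffunP => i; rewrite !ffunE; case: eqP. Qed.

Lemma upd_at (k : box) a x : upd k a x a = x.
Proof. by rewrite ffunE eqxx. Qed.

Lemma in_face_upd (A : {set 'I_D}) (k : box) a x : a \in A -> in_face A (upd k a x) = in_face A k.
Proof.
move=> Aa; rewrite /in_face; apply: eq_forallb => i /=.
by rewrite ffunE; case: (i =P a) => // ->; rewrite Aa.
Qed.

Lemma face_signD1 (A : {set 'I_D}) (k : box) a :
  a \in A -> face_sign A k = (-1) ^+ k a * face_sign (A :\ a) k.
Proof. by move=> Aa; rewrite /face_sign (big_setD1 a). Qed.

Lemma face_sign_upd (A : {set 'I_D}) (k : box) a x :
  a \in A -> face_sign A (upd k a x) = (-1) ^+ x * face_sign (A :\ a) k.
Proof.
move=> Aa; rewrite (face_signD1 _ Aa) upd_at; congr (_ * _).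
by apply: eq_bigr => i; rewrite !inE ffunE => /andP[/negPf->].
Qed.

Lemma in_faceD1 (A : {set 'I_D}) (k : box) a : a \in A ->
  in_face (A :\ a) k = in_face A k && (k a == ord_max).
Proof.
move=> Aa; apply/forallP/andP => [h | [/forallP h ka] i].
  split; last by have := h a; rewrite !inE eqxx.
  by apply/forallP => i; apply/implyP => nAi; have := h i; rewrite !inE (negPf nAi) andbF.
by rewrite !inE negb_and negbK; case: eqP => [->|_] //=; apply: h.
Qed.

(** A backward edge is the forward edge of the preceding node, which has the opposite sign. Only the
    forward edges of the layer at [f] survive, with sign -1 in direction [a] as [f] is odd. *)
Lemma face_telescope (A : {set 'I_D}) a : a \in A ->
  \sum_(k | in_face A k) face_sign A k * (X a k + Y a k) = - face_sum (A :\ a) a.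
Proof.
move=> Aa; rewrite (eq_bigr _ (fun k _ => mulrDr _ _ _)) big_split /=.
rewrite (bigID (fun k : box => k a == ord_max)) /=.
rewrite [X in _ + X](bigID (fun k : box => k a == ord0)) /=.
rewrite [X in _ + (X + _)]big1 => [|k /andP[_ /eqP k0]]; last by rewrite Y0 ?mulr0.
have ord_maxE (x : 'I_f.+1) : (x == ord_max) = (x == f :> nat) by [].
have -> : \sum_(k | in_face A k && (k a != ord0)) face_sign A k * Y a k =
    - \sum_(k | in_face A k && (k a != ord_max)) face_sign A k * X a k.
  rewrite -sumrN (reindex_onto (fun k : box => upd k a (inord (k a).+1))
                               (fun k : box => upd k a (inord (k a).-1))) /=; last first.
    move=> k /andP[_ k0]; rewrite upd_upd upd_at; apply: upd_id; apply: val_inj.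
    have := ltn_ord (k a); have : (k a != 0 :> nat) by [].
    by move=> *; rewrite /= !inordK; lia.
  apply: eq_big => [k | k /andP[/andP[_ k0] _]].
    rewrite in_face_upd // upd_at -andbA; congr (_ && _); rewrite ord_maxE.
    have := ltn_ord (k a); rewrite ltnS leq_eqVlt => /predU1P[ka | lt_ka].
      (* [inord] sends [f.+1] to its default [ord0], so nodes with coordinate [f] fail both
         conditions. *)
      rewrite ka eqxx; suff -> : inord f.+1 = ord0 :> 'I_f.+1 by rewrite eqxx.
      by apply: val_inj; rewrite /inord /insubd insubN //= ltnn.
    rewrite (ltn_eqF lt_ka) upd_upd upd_id; last first.
      by apply: val_inj; rewrite /= !inordK //= ltnS // ltnW.
    by rewrite eqxx andbT -val_eqE /= inordK.
  have lt_ka : (k a < f)%N.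
    have := ltn_ord (k a); rewrite ltnS leq_eqVlt => /predU1P[ka | //].
    move: k0; rewrite upd_at ka; suff -> : inord f.+1 = ord0 :> 'I_f.+1 by rewrite eqxx.
    by apply: val_inj; rewrite /inord /insubd insubN //= ltnn.
  rewrite YS // face_sign_upd // (face_signD1 k Aa) inordK // exprS.
  by ring.
rewrite add0r addrK -sumrN; apply: eq_big => [k | k /andP[_ /eqP ka]].
  by rewrite in_faceD1.
by rewrite (face_signD1 k Aa) ka /= -signr_odd odd_f expr1 !mulNr mul1r.
Qed.

(** Reflecting one coordinate in [A] changes the sign, as [f] is odd; for empty [A] the face is a
    single node. *)
Lemma face_sign_sum A :
  \sum_(k | in_face A k) face_sign A k = (A == set0)%:R.
Proof.
have [-> | [a Aa]] := set_0Vmem A.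
  rewrite eqxx (big_pred1 [ffun => ord_max]) => [|k].
    by rewrite /face_sign big_set0.
  apply/forallP/eqP => [h | -> i]; last by rewrite ffunE eqxx implybT.
  by apply/ffunP => i; have := h i; rewrite inE ffunE => /eqP.
have -> : (A == set0) = false by apply/eqP => A0; rewrite A0 inE in Aa.
set S := LHS.
suff : S = - S by move/eqP; rewrite -addr_eq0 -mulr2n mulrn_eq0 => /eqP.
rewrite {1}/S (reindex_inj (h := fun k : box => upd k a (rev_ord (k a)))) /=; last first.
  apply: can_inj (fun k : box => upd k a (rev_ord (k a))) _ => k.
  by rewrite upd_at upd_upd upd_id // rev_ordK.
rewrite -sumrN; apply: eq_big => [k | k _]; first by rewrite in_face_upd.
rewrite face_sign_upd // (face_signD1 k Aa) /= subSS -mulNr; congr (_ * _).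
have le_kf : (k a <= f)%N by rewrite -ltnS.
rewrite -[in LHS]signr_odd oddB // odd_f -[in RHS]signr_odd /=.
by case: (odd _); rewrite ?expr0 ?expr1 ?opprK.
Qed.

(** A direction outside [A] has coordinate [f] on the whole face, so every node there is saturated.
    Such directions count twice by [Y_max]; those in [A] telescope. *)
Lemma face_sum_rec (A : {set 'I_D}) : A != setT ->
  2%:R * (\sum_(b | b \notin A) face_sum A b) - \sum_(a in A) face_sum (A :\ a) a
  = (A == set0)%:R.
Proof.
move=> AT; have /existsP[b0 Ab0] : [exists b, b \notin A].
  by rewrite -negb_forall; apply: contra AT => /forallP h; apply/eqP/setP => b; rewrite h inE.
rewrite -face_sign_sum mulr_sumr -sumrN.
pose G a := \sum_(k | in_face A k) face_sign A k * (X a k + Y a k).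
rewrite [X in X + _](eq_bigr G) => [|b Ab]; last first.
  rewrite /face_sum mulr_sumr; apply: eq_bigr => k /forallP kA.
  rewrite Y_max; first by ring.
  by apply/eqP; have := kA b; rewrite Ab.
rewrite [X in _ + X](eq_bigr G) => [|a Aa]; last by rewrite /G face_telescope.
rewrite addrC; transitivity (\sum_a G a); first by rewrite [RHS](bigID (mem A)).
rewrite exchange_big /=; apply: eq_bigr => k /forallP kA.
rewrite -mulr_sumr (saturated (i := b0)) ?mulr1 //.
by apply/eqP; have := kA b0; rewrite Ab0.
Qed.

(* Weighting the identities of the faces A by 2 ^ #|A| makes every term with
   b |: A <> setT cancel. *)
Lemma face_sum_setT : (0 < D)%N ->
  2%:R ^+ D * (\sum_b face_sum (~: [set b]) b) = 1.
Proof.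
move=> D_gt0.
(* Scaling [face_sum_rec] by [2 ^ #|A|] turns both sums into sums of [F]: the extra unit in the
   exponent comes from the coefficient 2 in the first and from the removed element in the second. *)
pose F (A : {set 'I_D}) b := 2%:R ^+ #|A|.+1 * face_sum A b.
have E1 : \sum_(A : {set 'I_D} | A != setT) (\sum_(b | b \notin A) F A b - \sum_(a in A) F (A :\ a) a) = 1.
  rewrite (bigD1 set0) /=; last first.
    by apply/eqP => /setP/(_ (Ordinal D_gt0)); rewrite !inE.
  rewrite [X in _ + X]big1 => [|A /andP[AT A0]].
    rewrite addr0 [X in _ - X]big_set0 subr0.
    have set0T : set0 != [set: 'I_D].
      by apply/eqP => /setP/(_ (Ordinal D_gt0)); rewrite !inE.
    have := face_sum_rec set0T; rewrite eqxx big_set0 subr0 => E0; rewrite -[RHS]E0.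
    by rewrite mulr_sumr; apply: eq_bigr => b _; rewrite /F cards0 expr1.
  have := face_sum_rec AT; rewrite (negPf A0) => /(congr1 ( *%R (2%:R ^+ #|A|))); rewrite mulr0 => E; rewrite -[RHS]E.
  rewrite mulrBr mulrA -exprSr !mulr_sumr.
  by congr (_ - _); apply: eq_bigr => a Aa; rewrite /F (cardsD1 a A) Aa.
set lhs := LHS; rewrite -[RHS]E1 sumrB !pair_big_dep /=.
rewrite (bigID (fun p : {set 'I_D} * 'I_D => p.2 |: p.1 == setT)) /=.
(* The pairs with [b \in A] of the second sum, sent to [(A :\ b, b)], are exactly the pairs of the
   first sum with [b |: A != setT]. *)
rewrite [X in _ + X - _](reindex_onto (fun p : {set 'I_D} * 'I_D => (p.1 :\ p.2, p.2))
                                (fun p => (p.2 |: p.1, p.2))) /=; last first.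
  by move=> [A b] /= /andP[/andP[_ Ab] _]; rewrite setU1K.
rewrite [X in _ + X - _](eq_bigl (fun p : {set 'I_D} * 'I_D => (p.1 != setT) && (p.2 \in p.1))) /=; last first.
  move=> [A b] /=; rewrite !inE eqxx /= andbT xpair_eqE eqxx andbT.
  apply/andP/andP => [[/andP[ADT ADb] /eqP eA] | [AT Ab]].
    by rewrite eA in ADb; split; rewrite // -eA setU11.
  rewrite setD1K // eqxx AT andbT; split => //.
  by apply/eqP => /setP/(_ b); rewrite !inE eqxx.
rewrite addrK.
rewrite (reindex_onto (fun b => (~: [set b], b)) snd) /=; last first.
  move=> [A b] /= /andP[/andP[AT Ab] /eqP/setP bA]; congr (_, _).
  apply/setP => i; rewrite !inE; have := bA i; rewrite !inE.
  by case: eqP => //= ->; rewrite (negPf Ab).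
rewrite /lhs mulr_sumr; apply: eq_big => [b | b _].
  rewrite !inE !eqxx setUCr eqxx !andbT /=; apply/esym/eqP => /setP/(_ b).
  by rewrite !inE eqxx.
by rewrite /F cardsC1 card_ord prednK.
Qed.

End GridIdentity.

(** * The 2-adic valuation of sums of allowed values *)

Section Denominators.
Local Open Scope ring_scope.

(** The witness is the odd part of the factorial of [2 ^ d]. The odd part of each denominator
    divides it, and the power of 2 in the denominator divides [2 ^ d]. *)
Lemma allowed_value_int d : exists2 m : nat, odd m &
  forall q, allowed_value d q -> (m * 2 ^ d)%:R * q \is a Num.int.
Proof.
exists ((2 ^ d)`!`_2^')%N.
  by rewrite -[odd _]negbK -dvdn2 -p'natE ?part_pnat.
move=> _ [a [b [_ /andP[b_gt0 le_b] ->]]].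
have /dvdnP[c ->] : (b %| (2 ^ d)`!`_2^' * 2 ^ d)%N.
  rewrite -(partnC 2%N b_gt0) mulnC; apply: dvdn_mul.
    by apply: partn_dvd; rewrite ?fact_gt0 // dvdn_fact // b_gt0.
  rewrite p_part; apply: dvdn_exp2l; rewrite -(@leq_exp2l 2%N) //.
  by apply: leq_trans le_b; apply: dvdn_leq => //; apply: pfactor_dvdnn.
suff -> : (c * b)%:R * (a%:R / b%:R) = (c * a)%:R :> rat by apply: rpred_nat.
have b_neq0 : b%:R != 0 :> rat by rewrite pnatr_eq0 -lt0n.
by rewrite !natrM; field.
Qed.

(** Were the product 1, multiplying by the odd [m] of [allowed_value_int] would make [m] twice an
    integer. *)
Lemma int_sum_allowed (I J : finType) (P : I -> pred J) (s x : I -> J -> rat) d :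
  (forall i j, s i j \is a Num.int) ->
  (forall i j, P i j -> allowed_value d (x i j)) ->
  2%:R ^+ d.+1 * (\sum_i \sum_(j | P i j) s i j * x i j) != 1.
Proof.
move=> int_s allowed_x; have [m odd_m int_m] := allowed_value_int d; apply/eqP => sum1.
have : m%:R = 2%:R * ((m * 2 ^ d)%:R * (\sum_i \sum_(j | P i j) s i j * x i j)).
  by rewrite -[LHS]mulr1 -[X in _ * X = _]sum1 exprS natrM natrX; ring.
set z := _ * (\sum_i _).
have /intrP[c ->] : z \is a Num.int.
  rewrite /z mulr_sumr rpred_sum // => i _; rewrite mulr_sumr rpred_sum // => j Pij.
  by rewrite mulrCA rpredM //; apply/int_m/allowed_x.
rewrite -[2%:R]/(2%:~R) -intrM -[m%:R]/(m%:~R) => /intr_inj; lia.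
Qed.

End Denominators.
(** * Grid graphs on words of identifiers *)

(** Ports follow the enumeration of the vertex type, so a node with the same neighbours in two
    graphs on that type has the same ports in both. *)
Definition ports (G : graph) (v : G) : seq G := enum (adj v).

Lemma port_numbering_ports (G : graph) : port_numbering (@ports G).
Proof. by move=> v; split => [|u]; rewrite ?enum_uniq // mem_enum. Qed.

Definition rank_id (G : graph) (v : G) : nat := (enum_rank v).+1.

Lemma identifiers_rank_id c (G : graph) : 0 < c -> identifiers c (@rank_id G).
Proof.
move=> c_gt0; split=> [u v [/val_inj/enum_rank_inj] // | v].
rewrite /rank_id /=; apply: leq_trans (ltn_ord _) _.
have [G0 | G_gt0] := posnP #|G|; first by have := fintype0 v G0.
by rewrite -{1}[#|G|]expn1 leq_pexp2l.
Qed.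

(** * Dependence of a run on neighbourhoods *)

Section Locality.

Variables (V : finType) (e e' : rel V).
Hypotheses (sym_e : symmetric e) (irr_e : irreflexive e).
Hypotheses (sym_e' : symmetric e') (irr_e' : irreflexive e').
Let G := Graph sym_e irr_e.
Let G' := Graph sym_e' irr_e'.

(** The two graphs have the same edges at every node within distance [t] of [v]. *)
Fixpoint agree (t : nat) (v : V) : Prop :=
  e v =1 e' v /\ (if t is t'.+1 then forall u, e v u -> agree t' u else True).

Lemma agree1 t v : agree t v -> e v =1 e' v.
Proof. by case: t => [|t] []. Qed.

Lemma agreeW t v : agree t.+1 v -> agree t v.
Proof.
elim: t v => [|t IHt] v [eq_v eq_u]; first by [].
by split=> // u /eq_u; apply: IHt.
Qed.

Lemma agree_ports t v : agree t v -> @ports G v = @ports G' v.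
Proof. by move=> /agree1 eq_v; apply: eq_enum => u; apply: eq_v. Qed.

Lemma agree_run (A : local_algorithm) (id : V -> nat) t v : agree t v ->
  run A (G := G) (@ports G) id t v = run A (G := G') (@ports G') id t v.
Proof.
elim: t v => [|t IHt] v.
  case=> eq_v _; congr (init _ _ _); apply: eq_card => u; exact: eq_v.
move=> ag_v; have [_ ag_u] := ag_v; rewrite /= (IHt v (agreeW ag_v)).
case: (output _) => //; congr (recv _ _).
rewrite -(agree_ports ag_v); apply/eq_in_map => u; rewrite mem_enum => /ag_u ag.
by rewrite (IHt u ag) (agree_ports ag).
Qed.

End Locality.

Definition announced (A : local_algorithm) (G : graph) (id : G -> nat) t (v u : G) : rat :=
  if output (run A (@ports G) id t v) is Some o then o (index u (ports v)) else 0%R.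

Lemma announcedE (A : local_algorithm) (G : graph) (id : G -> nat) t x (v u : G) :
  computes_within A (@ports G) id t x -> adj v u -> announced A id t v u = x [set v; u].
Proof. by move=> comp_x v_u; rewrite /announced; have [o ->] := comp_x v; apply. Qed.

Section Load.
Local Open Scope ring_scope.

Lemma load_neighbours (G : graph) (x : {set G} -> rat) (v : G) :
  load x v = \sum_(u | adj v u) x [set v; u].
Proof.
have inj : {in [set u | adj v u] &, injective (fun u => [set v; u])}.
  move=> u w; rewrite !inE => v_u v_w /setP eq_uw.
  have := eq_uw u; rewrite !inE eqxx orbT; case/esym/orP => /eqP // uv.
  by rewrite uv adj_irrefl in v_u.
rewrite /load (eq_bigl (mem [set [set v; u] | u in [set u | adj v u]])).
  by rewrite big_imset //=; apply: eq_bigl => u; rewrite inE.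
move=> e; apply/andP/imsetP => [[] | [u]]; last first.
  rewrite inE => v_u ->; split; last by rewrite !inE eqxx.
  by rewrite inE; apply/existsP; exists v; apply/existsP; exists u; rewrite v_u /=.
rewrite inE => /existsP[a /existsP[b /andP[a_b /eqP->]]]; rewrite !inE => /orP[] /eqP vE.
  by exists b; rewrite ?inE vE.
by exists a; rewrite ?inE vE // 1?setUC // adj_sym.
Qed.

End Load.

Definition next_to (s : seq nat) (a b : nat) : bool :=
  [&& a \in s, b \in s
    & (index b s == (index a s).+1) || (index a s == (index b s).+1)].

Lemma next_to_nth s j a : uniq s -> j < size s ->
  next_to s (nth 0 s j) a =
  (j.+1 < size s) && (a == nth 0 s j.+1) || (0 < j) && (a == nth 0 s j.-1).
Proof.
move=> uniq_s lt_j; rewrite /next_to mem_nth //= index_uniq //.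
apply/andP/orP => [[s_a /orP[]/eqP ind_a] | ].
- by left; rewrite -ind_a index_mem s_a nth_index /=.
- by right; rewrite ind_a /= nth_index.
case=> /andP[h /eqP->]; rewrite ?mem_nth ?index_uniq ?eqxx //; try lia.
Qed.

(** The strict bounds keep both neighbours of position [j] inside the window. With [o = 0] no left
    margin is needed, since the path starts there too. *)
Lemma next_to_window s o w j a : uniq s -> o + w <= size s ->
  (o == 0) || (o < j) -> j.+1 < o + w ->
  next_to (take w (drop o s)) (nth 0 s j) a = next_to s (nth 0 s j) a.
Proof.
move=> uniq_s le_w le_j lt_j; set s' := take w _.
have nthE i : o <= i < o + w -> nth 0 s i = nth 0 s' (i - o).
  by move=> lt_i; rewrite nth_take ?nth_drop ?subnKC //; lia.
have sz_s' : size s' = w by rewrite size_take size_drop; case: ltnP; lia.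
rewrite next_to_nth //; last by lia.
rewrite {1}nthE; last by case/orP: le_j; lia.
rewrite next_to_nth ?take_uniq ?drop_uniq ?sz_s' //; last by lia.
have -> : (j - o).+1 = j.+1 - o by case/orP: le_j; lia.
rewrite -nthE; last by case/orP: le_j; lia.
have -> : (j.+1 - o < w) = (j.+1 < size s) by lia.
congr (_ || _); have -> : (0 < j - o) = (0 < j) by case/orP: le_j; lia.
case: (posnP j) => //= j_gt0.
have -> : (j - o).-1 = j.-1 - o by case/orP: le_j; lia.
by rewrite -nthE //; case/orP: le_j; lia.
Qed.

Section Grid.

Variables D N : nat.
Implicit Types (S W : seq (seq nat)) (k : {ffun 'I_D -> nat}) (i b : 'I_D).

(* A vertex is a word of D letters, and letter i moves along the path listed by
   the i-th entry of S. All grids share this vertex set, so that the same word,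
   with the same identifier, can be compared in two grids; the words with
   letters outside the paths only pad the graph. *)
Definition grid_adj S (u v : {ffun 'I_D -> 'I_N.+1}) : bool :=
  [exists i, [forall j, (j != i) ==> (u j == v j)] && next_to (nth [::] S i) (u i) (v i)].

Lemma grid_adj_sym S : symmetric (grid_adj S).
Proof.
move=> u v; apply: eq_existsb => i; congr (_ && _).
  by apply: eq_forallb => j; rewrite [v j == u j]eq_sym.
by rewrite /next_to andbCA orbC.
Qed.

Lemma grid_adj_irrefl S : irreflexive (grid_adj S).
Proof.
move=> u; apply/negbTE/existsP => -[i /andP[_ /and3P[_ _]]].
by rewrite orbb eqn_leq ltnn andbF.
Qed.

Definition grid S : graph := Graph (grid_adj_sym S) (grid_adj_irrefl S).

Lemma max_degree_grid S : max_degree (grid S) <= D * 2.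
Proof.
apply/bigmax_leqP => v _.
pose h (p : 'I_D * bool) : {ffun 'I_D -> 'I_N.+1} :=
  let s := nth [::] S p.1 in let a := index (v p.1 : nat) s in
  [ffun j : 'I_D => if j == p.1 then inord (nth 0 s (if p.2 then a.+1 else a.-1)) else v j].
apply: leq_trans (_ : #|codom h| <= _).
  apply: subset_leq_card; apply/subsetP => u /existsP[i /andP[/forallP eq_u]].
  case/and3P => s_v s_u ind_u; apply/codomP.
  have uE a : nth 0 (nth [::] S i) a = u i -> 
      u = [ffun j : 'I_D => if j == i then inord (nth 0 (nth [::] S i) a) else v j].
    move=> ->; apply/ffunP => j; rewrite ffunE; case: eqP => [->|/eqP ji].
      by rewrite inord_val.
    by have := eq_u j; rewrite ji => /eqP.
  case/orP: ind_u => /eqP ind_u; [exists (i, true) | exists (i, false)];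
    by rewrite /h /=; apply: uE; rewrite ?ind_u /= -?ind_u nth_index.
by apply: leq_trans (leq_image_card _ _) _; rewrite card_prod card_ord card_bool.
Qed.

Definition paths L S : Prop :=
  forall i, [/\ uniq (nth [::] S i), size (nth [::] S i) = L & all (gtn N.+1) (nth [::] S i)].

Definition point S k : {ffun 'I_D -> 'I_N.+1} :=
  [ffun i : 'I_D => inord (nth 0 (nth [::] S i) (k i))].

(** Backward steps truncate at 0, whence the recurring condition [fwd || (0 < k i)]. *)
Definition step (fwd : bool) i k : {ffun 'I_D -> nat} :=
  [ffun j : 'I_D => if fwd then k j + (j == i) else k j - (j == i)].

Lemma val_point L S k i : paths L S -> k i < L ->
  point S k i = nth 0 (nth [::] S i) (k i) :> nat.
Proof.
move=> /(_ i)[_ sz lt_s] lt_k; rewrite ffunE inordK //.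
by apply: (allP lt_s); rewrite mem_nth ?sz.
Qed.

Lemma grid_adjP L S k u : paths L S -> (forall i, (k i).+1 < L) ->
  reflect (exists i fwd, (fwd || (0 < k i)) /\ u = point S (step fwd i k))
          (grid_adj S (point S k) u).
Proof.
move=> S_paths lt_k; have lt_k' (i : 'I_D) : k i < L by apply: ltnW.
apply: (iffP existsP) => [[i /andP[/forallP eq_u]] | [i [fwd [valid ->]]]]; last first.
  exists i; apply/andP; split.
    apply/forallP => j; apply/implyP => /negPf ji; rewrite !ffunE ji addn0 subn0.
    by case: (fwd).
  rewrite (val_point S_paths) // (val_point S_paths); last first.
    by rewrite ffunE eqxx; case: (fwd); have := lt_k i; lia.
  have [uniq_s sz_s _] := S_paths i.
  rewrite next_to_nth ?sz_s // lt_k ffunE eqxx addn1 subn1.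
  by case: fwd valid => /= [|->]; rewrite eqxx ?orbT.
have [uniq_s sz_s lt_s] := S_paths i.
rewrite (val_point S_paths) // next_to_nth ?sz_s // => ind_u.
have uE fwd : u i = nth 0 (nth [::] S i) (step fwd i k i) :> nat -> u = point S (step fwd i k).
  move=> u_i; apply/ffunP => j; have := eq_u j; case: (j =P i) => [-> _ | /eqP ji].
    by rewrite [RHS]ffunE -u_i inord_val.
  by move=> /eqP <-; rewrite !ffunE (negPf ji) addn0 subn0; case: (fwd).
case/orP: ind_u => /andP[h /eqP u_i]; [exists i, true | exists i, false]; split=> //;
  by apply: uE; rewrite u_i ffunE eqxx ?addn1 ?subn1.
Qed.

Lemma point_inj L S k k' : paths L S -> (forall i, k i < L) -> (forall i, k' i < L) ->
  point S k = point S k' -> k = k'.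
Proof.
move=> S_paths lt_k lt_k' /ffunP eq_p; apply/ffunP => i; apply/eqP.
have [uniq_s sz_s _] := S_paths i.
rewrite -(nth_uniq 0 _ _ uniq_s) ?sz_s //.
by rewrite -(val_point S_paths) // -(val_point S_paths) // eq_p.
Qed.

Lemma step_inj k i i' fwd fwd' : fwd || (0 < k i) -> fwd' || (0 < k i') ->
  step fwd i k = step fwd' i' k -> (i, fwd) = (i', fwd').
Proof.
move=> v v' /ffunP eq_s; have := eq_s i; rewrite !ffunE eqxx.
case: (i =P i') v' => [<-|_] v'; case: (fwd) (fwd') v v' => -[] /= v v' h //; exfalso; move: v v' h; move: (k i) (k i'); lia.
Qed.

Lemma load_point L S (x : {set {ffun 'I_D -> 'I_N.+1}} -> rat) k :
  paths L S -> (forall i, (k i).+1 < L) ->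
  (load (G := grid S) x (point S k) =
   \sum_i (x [set point S k; point S (step true i k)] +
           (if k i == 0 then 0 else x [set point S k; point S (step false i k)])))%R.
Proof.
move=> S_paths lt_k; rewrite load_neighbours.
pose h (p : 'I_D * bool) := point S (step p.2 p.1 k).
pose P := [set p : 'I_D * bool | p.2 || (0 < k p.1)].
have lt_step fwd (i j : 'I_D) : step fwd i k j < L.
  by rewrite ffunE; have := lt_k j; case: (fwd); case: (j == i); lia.
have inj_h : {in P &, injective h}.
  move=> [i fwd] [i' fwd']; rewrite !inE /= => v v' /(point_inj S_paths) eq_s.
  by apply: step_inj v v' _; apply: eq_s.
rewrite (eq_bigl (mem (h @: P))) => [|u]; last first.
  apply/(grid_adjP _ S_paths lt_k)/imsetP => [[i [fwd [v ->]]] | [[i fwd]]].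
    by exists (i, fwd); rewrite ?inE.
  by rewrite inE => v ->; exists i, fwd.
rewrite big_imset //= big_mkcond /=.
pose F i fwd := if (i, fwd) \in P then x [set point S k; h (i, fwd)] else 0%R.
rewrite (eq_bigr (fun p => F p.1 p.2)) => [|[i fwd] _] //.
rewrite -(pair_bigA _ F) /=.
apply: eq_bigr => i _; rewrite big_bool /F !inE /= lt0n.
by case: (k i == 0).
Qed.

Variables (L : nat) (S W : seq (seq nat)) (o : 'I_D -> nat) (w : nat).
Hypothesis S_paths : paths L S.
Hypothesis le_w : forall i, o i + w <= L.
Hypothesis windowE : forall i, nth [::] W i = take w (drop (o i) (nth [::] S i)).

Lemma point_window k : (forall i, k i < w) ->
  point W k = point S [ffun i : 'I_D => o i + k i].
Proof.
by move=> lt_k; apply/ffunP => i; rewrite !ffunE windowE nth_take // nth_drop.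
Qed.

(** A walk of [t] steps changes each coordinate by at most [t], so these margins keep every visited
    node where [next_to_window] applies. *)
Lemma agree_window t k :
  (forall i, ((o i == 0) || (o i + t < k i)) /\ k i + t + 1 < o i + w) ->
  agree (grid_adj S) (grid_adj W) t (point S k).
Proof.
elim: t k => [|t IHt] k in_k.
  split=> // u; apply: eq_existsb => i; congr (_ && _).
  have [uniq_s sz_s _] := S_paths i; have [h1 h2] := in_k i; have := le_w i => le_wi.
  rewrite (val_point S_paths); last by lia.
  by rewrite windowE next_to_window ?sz_s //; move: h1 h2; lia.
have lt_k (i : 'I_D) : (k i).+1 < L by have [_] := in_k i; have := le_w i; lia.
have ag0 : agree (grid_adj S) (grid_adj W) t (point S k).
  by apply: IHt => i; have := in_k i; lia.
split; first exact: agree1 ag0.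
move=> u /(grid_adjP _ S_paths lt_k)[i [fwd [v ->]]]; apply: IHt => j.
have := in_k j; rewrite ffunE; case: (fwd); case: (j == i); lia.
Qed.

End Grid.

(** * The colouring by announced values *)

Definition values (d : nat) : seq rat :=
  [seq (a%:R / b%:R)%R | a <- iota 0 (2 ^ d).+1, b <- iota 1 (2 ^ d)].

(** The additional code is for numbers outside the list, so that any announcement has one. *)
Definition value_code (d : nat) (q : rat) : 'I_(size (values d)).+1 :=
  inord (index q (values d)).

Lemma value_code_inj d q q' : allowed_value d q -> allowed_value d q' ->
  value_code d q = value_code d q' -> q = q'.
Proof.
have mem_values z : allowed_value d z -> z \in values d.
  move=> [a [b [le_a le_b ->]]]; apply/allpairsP; exists (a, b).
  by rewrite !mem_iota /= !add0n !ltnS.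
move=> /mem_values q_in /mem_values q'_in /(congr1 val) /=.
by rewrite !inordK ?ltnS ?index_size //; apply: index_inj.
Qed.

Definition nat_pos D f (k : {ffun 'I_D -> 'I_f.+1}) : {ffun 'I_D -> nat} :=
  [ffun i : 'I_D => val (k i)].

(** Running the algorithm on the grid spanned by the windows themselves makes the colour a function
    of the windows alone, as [shift_box] needs. *)
Definition grid_colour (A : local_algorithm) (d f N t : nat) (W : seq (seq nat)) :
    {ffun {ffun 'I_d.+1 -> 'I_f.+1} * 'I_d.+1 * bool -> 'I_(size (values d)).+1} :=
  [ffun p => value_code d (announced A (@rank_id (grid d.+1 N W)) t
     (point N W (nat_pos p.1.1)) (point N W (step p.2 p.1.2 (nat_pos p.1.1))))].

Section GridValues.
Local Open Scope ring_scope.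

Variables (A : local_algorithm) (d f N t : nat) (S : seq (seq nat)).
Notation D := d.+1.
Notation G := (grid D N S).
Variable x : {set G} -> rat.

Let windows := [seq take f.*2.+1 s | s <- S].

Hypothesis odd_f : odd f.
Hypothesis lt_tf : (t < f)%N.
Hypothesis S_paths : paths D N f.*2.+2 S.
Hypothesis x_max : maximal_fractional_matching x.
Hypothesis x_allowed : forall e, e \in edges G -> allowed_value d (x e).
Hypothesis A_x : computes_within A (@ports G) (@rank_id G) t x.
Hypothesis colour_eq : forall b : 'I_D,
  grid_colour A d f N t windows =
  grid_colour A d f N t (set_nth [::] windows b (behead (nth [::] S b))).

Lemma announced_window W (k : {ffun 'I_D -> nat}) u :
  agree (grid_adj (N := N) S) (grid_adj W) t (point N S k) ->
  announced A (@rank_id G) t (point N S k) u =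
  announced A (@rank_id (grid D N W)) t (point N S k) u.
Proof.
move=> ag; rewrite /announced.
have := agree_run (grid_adj_sym S) (grid_adj_irrefl S) (grid_adj_sym W)
  (grid_adj_irrefl W) A (@rank_id G) ag.
have := agree_ports (grid_adj_sym S) (grid_adj_irrefl S) (grid_adj_sym W)
  (grid_adj_irrefl W) ag.
by rewrite /grid /= => -> ->.
Qed.

Lemma adj_step (k : {ffun 'I_D -> nat}) fwd i : (forall j, (k j).+1 < f.*2.+2)%N -> fwd || (0 < k i)%N ->
  grid_adj S (point N S k) (point N S (step fwd i k)).
Proof. by move=> lt_k v; apply/(grid_adjP _ S_paths lt_k); exists i, fwd. Qed.

Lemma value_allowed (k : {ffun 'I_D -> nat}) fwd i : (forall j, (k j).+1 < f.*2.+2)%N -> fwd || (0 < k i)%N ->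
  allowed_value d (x [set point N S k; point N S (step fwd i k)]).
Proof.
move=> lt_k v; apply: x_allowed; rewrite inE; apply/existsP.
exists (point N S k); apply/existsP; exists (point N S (step fwd i k)).
by rewrite eqxx andbT; apply: adj_step.
Qed.

Lemma step_comm (k : {ffun 'I_D -> nat}) b i fwd : (0 < k b)%N -> fwd || (0 < k i)%N ->
  step fwd i (step true b k) = step true b (step fwd i k).
Proof.
move=> kb v; apply/ffunP => j; rewrite !ffunE.
case: fwd v => /= v; first by rewrite addnAC.
by case: (j =P i) => [->|_]; case: (_ == b); lia.
Qed.

(* The node at k sees in the grid on the first windows what the node one step
   further along b sees when the window of direction b is moved by one. *)
Lemma value_shift (k : {ffun 'I_D -> 'I_f.+1}) b i fwd :
  k b = ord_max -> fwd || (0 < k i)%N ->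
  x [set point N S (nat_pos k); point N S (step fwd i (nat_pos k))] =
  x [set point N S (step true b (nat_pos k));
         point N S (step fwd i (step true b (nat_pos k)))].
Proof.
move=> kb v; set k0 := nat_pos k; set k1 := step true b k0.
have f_gt0 : (0 < f)%N by case: (f) odd_f.
have k0E j : k0 j = k j :> nat by rewrite ffunE.
have k1E j : k1 j = (k j + (j == b))%N by rewrite ffunE k0E.
have le_k0 j : (k0 j <= f)%N by rewrite k0E -ltnS ltn_ord.
have k0b : k0 b = f by rewrite k0E kb.
have v0 : fwd || (0 < k0 i)%N by rewrite k0E.
have v1 : fwd || (0 < k1 i)%N by rewrite k1E; case: (fwd) v; rewrite //= addn_gt0 => ->.
have lt0 j : ((k0 j).+1 < f.*2.+2)%N by have := le_k0 j; lia.
have lt1 j : ((k1 j).+1 < f.*2.+2)%N.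
  by rewrite k1E -k0E; have := le_k0 j; case: (j == b); lia.
have lt_step j : (step fwd i k0 j < f.*2.+1)%N.
  by rewrite ffunE; have := le_k0 j; case: (fwd); case: (j == i); lia.
apply: (value_code_inj (value_allowed lt0 v0) (value_allowed lt1 v1)).
pose W := set_nth [::] windows b (behead (nth [::] S b)).
have win0 j : nth [::] windows j = take f.*2.+1 (drop 0 (nth [::] S j)) :> seq nat.
  move=> *; rewrite drop0; case: (ltnP j (size S)) => lt_j; first by rewrite (nth_map [::]).
  by rewrite !nth_default ?size_map.
have win1 (j : 'I_D) : nth [::] W j = take f.*2.+1 (drop (j == b) (nth [::] S j)).
  rewrite nth_set_nth /= -val_eqE /=; case: eqP => [->|_]; last by rewrite win0.
  by have [_ sz _] := S_paths b; rewrite drop1 take_oversize // size_behead sz.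
rewrite -(announcedE A_x (adj_step lt0 v0)) -(announcedE A_x (adj_step lt1 v1)).
rewrite (@announced_window windows); last first.
  apply: (agree_window (o := fun=> 0%N) (w := f.*2.+1) S_paths) => // j.
  by have := le_k0 j; lia.
(* In direction [b] the shifted window starts at position 1 and the node sits at [f.+1], which
   leaves a left margin above [t]. *)
rewrite (@announced_window W); last first.
  apply: (agree_window (o := fun j => (j == b : nat)) (w := f.*2.+1) S_paths) => // j.
    by case: (j == b); lia.
  by rewrite k1E -k0E; case: (j =P b) => [->|_]; rewrite ?k0b /=; [|have := le_k0 j]; lia.
have p0 (k' : {ffun 'I_D -> nat}) : (forall j, k' j < f.*2.+1)%N -> point N windows k' = point N S k'.
  move=> lt_k'; rewrite (@point_window D N S windows (fun=> 0%N) f.*2.+1 (fun j => win0 j) k' lt_k').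
  by congr point; apply/ffunP => j; rewrite ffunE.
have p1 (k' : {ffun 'I_D -> nat}) : (forall j, k' j < f.*2.+1)%N -> point N W k' = point N S (step true b k').
  move=> lt_k'; rewrite (@point_window D N S W (fun j => (j == b : nat)) f.*2.+1 win1 k' lt_k').
  by congr point; apply/ffunP => j; rewrite !ffunE addnC.
have lt_k0 j : (k0 j < f.*2.+1)%N by have := le_k0 j; lia.
rewrite /k1 step_comm ?k0b // -(p1 k0) // -(p1 (step fwd i k0)) //.
rewrite -(p0 k0) // -(p0 (step fwd i k0)) //.
have /ffunP/(_ (k, i, fwd)) := colour_eq b.
by rewrite !ffunE.
Qed.

Lemma grid_values_contradiction : False.
Proof.
have f_gt0 : (0 < f)%N by case: (f) odd_f.
pose X i (k : {ffun 'I_D -> 'I_f.+1}) :=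
  x [set point N S (nat_pos k); point N S (step true i (nat_pos k))].
pose Y i (k : {ffun 'I_D -> 'I_f.+1}) := if k i == 0%N :> nat then 0 else
  x [set point N S (nat_pos k); point N S (step false i (nat_pos k))].
have posE (k : {ffun 'I_D -> 'I_f.+1}) i : nat_pos k i = k i by rewrite ffunE.
have lt_pos (k : {ffun 'I_D -> 'I_f.+1}) i : ((nat_pos k i).+1 < f.*2.+2)%N.
  by rewrite posE; have := ltn_ord (k i); lia.
have lt_step b (k : {ffun 'I_D -> 'I_f.+1}) i : ((step true b (nat_pos k) i).+1 < f.*2.+2)%N.
  by rewrite ffunE posE; have := ltn_ord (k i); case: (i == b); lia.
have stepK (k : {ffun 'I_D -> nat}) i : step false i (step true i k) = k.
  by apply/ffunP => j; rewrite !ffunE addnK.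
have Y0 i (k : {ffun 'I_D -> 'I_f.+1}) : k i = ord0 -> Y i k = 0.
  by rewrite /Y => ->.
have YS i (k : {ffun 'I_D -> 'I_f.+1}) :
    (k i < f)%N -> Y i (upd k i (inord (k i).+1)) = X i k.
  move=> lt_k; rewrite /Y upd_at inordK //=.
  suff -> : nat_pos (upd k i (inord (k i).+1)) = step true i (nat_pos k).
    by rewrite stepK setUC.
  apply/ffunP => j; rewrite !ffunE; case: (j =P i) => [->|_]; last by rewrite addn0.
  by rewrite /= inordK // addn1.
(* By [value_shift] the backward edge of [k] has the value of the backward edge of the next node,
   which is the forward edge of [k]. *)
have Y_max i (k : {ffun 'I_D -> 'I_f.+1}) : k i = ord_max -> Y i k = X i k.
  move=> ki; rewrite /Y ki /= -[(f == 0)%N]negbK -lt0n f_gt0 /=.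
  by rewrite (value_shift ki) ?ki //= stepK setUC.
have sat (k : {ffun 'I_D -> 'I_f.+1}) b : k b = ord_max -> \sum_i (X i k + Y i k) = 1.
  move=> kb; have [_ /(_ (point N S (nat_pos k)) (point N S (step true b (nat_pos k))))] := x_max.
  rewrite (load_point x S_paths (lt_pos k)) (load_point x S_paths (lt_step b k)).
  set l := \sum_i _; set l' := \sum_i _; suff -> : l' = l.
    under eq_bigr do rewrite /Y -posE.
    by case; first exact: adj_step.
  apply: eq_bigr => i _; rewrite -(value_shift kb) //; congr (_ + _).
  have -> : (step true b (nat_pos k) i == 0)%N = (nat_pos k i == 0)%N.
    by rewrite ffunE; case: (i =P b) => [->|_]; rewrite ?addn0 // posE kb /=; lia.
  by case: eqP => // /eqP ki; rewrite -(value_shift kb) //= -posE lt0n.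
have := face_sum_setT odd_f Y0 YS Y_max sat isT.
apply/eqP/int_sum_allowed => [b k | b k _].
  by apply: rpred_prod => i _; rewrite rpredX // rpredN rpred1.
by apply: value_allowed.
Qed.

End GridValues.

(** This makes the final grid large enough for the asymptotic bound on [T]. *)
Lemma box_bound_gt r q D : 0 < q -> 0 < D -> r < box_bound r q D.
Proof.
move=> q_gt0; case: D => // D _ /=; rewrite addnS ltnS.
apply: leq_trans (leq_addl _ _); apply: leq_trans (leq_tower1 r) (tower_mono r _).
by rewrite expn_gt0 q_gt0.
Qed.

Theorem theorem1p2 (d c : nat) (c_ge1 : 1 <= c) :
  ~ exists (A : local_algorithm) (T : nat -> nat),
      little_o T log_star /\
      forall (G : graph) (p : G -> seq G) (id : G -> nat),
        port_numbering p -> identifiers c id -> max_degree G <= 2 * d + 2 ->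
        exists x : {set G} -> rat,
          [/\ maximal_fractional_matching x,
              forall e, e \in edges G -> allowed_value d (x e)
            & computes_within A p id (T #|G|) x].
Proof.
move=> [A [T [T_small A_correct]]].
pose Q := (size (values d)).+1; pose K := 9 * d.+1 + 15.
(* This choice yields [K * 2 * T n <= log_star n <= K * f], hence [T n < f]. *)
have [|n0 T_le] := T_small ((K * 2)%:R^-1)%R.
  by rewrite invr_gt0 ltr0n.
(* [f] is odd, exceeds [n0] to force [n0 <= n], and exceeds [Q * d.+1 * 2] as [log_star_box_bound]
   requires. *)
pose f := (n0 + Q * d.+1 * 2).*2.+1.
pose C := {ffun {ffun 'I_d.+1 -> 'I_f.+1} * 'I_d.+1 * bool -> 'I_Q}.
(* The number of colours depends on [f] and not on the number of rounds, so the grid size is fixed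
   before [T] is evaluated at it. *)
pose N := box_bound f.*2 #|{: C}| d.+1.
have cardC : #|{: C}| = Q ^ (f.+1 ^ d.+1 * d.+1 * 2).
  by rewrite card_ffun !card_prod card_ffun !card_ord card_bool.
pose n := N.+1 ^ d.+1.
have log_n : log_star n <= K * f.
  by rewrite /n /N cardC; apply: log_star_box_bound; rewrite // /f; lia.
have lt_fN : f.*2 < N by apply: box_bound_gt; rewrite // cardC expn_gt0.
have le_n0 : n0 <= n.
  apply: (@leq_trans N.+1); first by rewrite /f in lt_fN; lia.
  by rewrite /n expnS leq_pmulr // expn_gt0.
have lt_Tf : T n < f.
  have := T_le n le_n0; rewrite ler_pdivlMl ?ltr0n // -natrM ler_nat => le_T.
  have : K * 2 * T n <= K * f by apply: leq_trans log_n.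
  by rewrite -mulnA leq_pmul2l // /f; lia.
have [S [sz_S inc_S colour_eq]] := @shift_box f.*2 d.+1 C (grid_colour A d f N (T n)).
have S_paths : paths d.+1 N f.*2.+2 S.
  move=> i; have : nth [::] S i \in S by rewrite mem_nth ?sz_S.
  move=> /(allP inc_S) /and3P[s_sorted /eqP sz_s lt_s]; split=> //.
    exact: sorted_uniq ltn_trans ltnn _ s_sorted.
  by apply: sub_all lt_s => y /= /leqW.
pose G := grid d.+1 N S.
have card_G : #|G| = n by rewrite card_ffun !card_ord.
have [||| x [x_max x_allowed A_x]] := A_correct G (@ports G) (@rank_id G).
- exact: port_numbering_ports.
- exact: identifiers_rank_id.
- by apply: leq_trans (max_degree_grid _ _ _) _; lia.
rewrite card_G in A_x.
apply: (grid_values_contradiction _ lt_Tf S_paths x_max x_allowed A_x) => [|b].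
  by rewrite /f /= odd_double.
exact: colour_eq.
Qed.
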